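(* Let $n$ be a positive integer. If two $m$-component welded string links $\sigma$ and $\sigma'$ are $(V^{n}+\mathrm{sv})$-equivalent, then $\mu^{\mathrm w}_{\sigma}(I)\equiv\mu^{\mathrm w}_{\sigma'}(I)\pmod n$ for every non-repeated sequence $I$ of elements of $\{1,\dots,m\}$.
   Context: Welded string links: equivalence classes of ordered oriented $m$-strand virtual string link diagrams (double points classical or virtual crossings) under welded Reidemeister moves R1–R3, V1–V4 and OC (welded isotopy). Welded Milnor invariants: label the arcs of the $i$th strand $a_{i1},\dots,a_{ir(i)}$ in order (arcs end at classical undercrossings); the Wirtinger presentation of $G(\sigma)$ has relations $a_{i,j+1}^{-1}u_{ij}^{-1}a_{ij}u_{ij}$ with $u_{ij}$ the over-arc generator at the relevant crossing or its inverse according to the crossing sign. Set $v_{ij}=u_{i1}\cdots u_{ij}$ and $l_i=a_{i1}^{s}v_{i,r(i)-1}$ with $s$ such that the total exponent of $i$th-component generators in $l_i$ is zero. Modulo the $q$th lower central series term, $l_i$ is a word $\lambda_i$ in the images $\alpha_1,\dots,\alpha_m$ of $a_{11},\dots,a_{m1}$; with Magnus expansion $E(\alpha_i)=1+X_i$, $E(\alpha_i^{-1})=\sum_{t\ge0}(-X_i)^t$ in $\mathbb Z\langle\langle X_1,\dots,X_m\rangle\rangle$, $\mu^{\mathrm w}_\sigma(j_1\dots j_k i)$ ($k<q$) is the coefficient of $X_{j_1}\cdots X_{j_k}$ in $E(\lambda_i)$. A sequence is non-repeated if its entries are pairwise distinct. A $V^n$-move: on two oriented strands in a disk, replace two parallel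 crossingless strands by a configuration where one strand passes under the other $n$ times consecutively at classical crossings of the same sign, crossing back via a virtual crossing after each (and the inverse). Self-crossing virtualization: replace a classical crossing between strands of the same component by a virtual one, or conversely. $(V^n+\mathrm{sv})$-equivalence is generated by $V^n$-moves, self-crossing virtualizations and welded isotopy. *)

(* Defs.v *)
(* Welded string links are modelled by Gauss diagrams on m
   ordered oriented intervals (strands). *)
From mathcomp Require Import all_boot all_order all_algebra.
From Stdlib Require Import Relations.Relation_Operators.
Set Implicit Arguments. Unset Strict Implicit. Unset Printing Implicit Defensive.
Import Order.TTheory GRing.Theory Num.Theory.

(* An endpoint of an arrow: ((label, is_head), sign).  A tail (is_head=false)
   is the over-passing point of a classical crossing, a head (is_head=true) the
   under-passing point; sign=true means a positive crossing. *)
Definition ep := ((nat * bool) * bool)%type.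
Definition lab (e : ep) : nat := e.1.1.
Definition is_head (e : ep) : bool := e.1.2.
Definition esign (e : ep) : bool := e.2.
Definition tl (a : nat) (s : bool) : ep := ((a, false), s).
Definition hd (a : nat) (s : bool) : ep := ((a, true), s).
Definition ep0 : ep := ((0, false), false).

(* strand i = the list of endpoints met along the i-th strand (0-based),
   in the order given by the orientation *)
Definition diagram := seq (seq ep).

Definition wf (D : diagram) : Prop :=
  let E := flatten D in
  uniq [seq e.1 | e <- E] /\
  (forall e, e \in E -> ((lab e, ~~ is_head e), esign e) \in E).

Definition remove_labs (L : seq nat) (D : diagram) : diagram :=
  map (filter (fun e => lab e \notin L)) D.

Definition ent (D : diagram) (i p : nat) : ep := nth ep0 (nth [::] D i) p.

Definition swap_adj (D : diagram) (i p : nat) : diagram :=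
  let s := nth [::] D i in
  set_nth [::] D i (set_nth ep0 (set_nth ep0 s p (nth ep0 s p.+1)) p.+1 (nth ep0 s p)).

Definition in_range (D : diagram) (i p : nat) : bool :=
  (i < size D) && (p.+1 < size (nth [::] D i)).

Definition R1move (D D' : diagram) : Prop :=
  exists a eps, D = remove_labs [:: a] D' /\
   exists2 s, s \in D' &
     infix [:: tl a eps; hd a eps] s || infix [:: hd a eps; tl a eps] s.

Definition R2move (D D' : diagram) : Prop :=
  exists a b eps, a != b /\ D = remove_labs [:: a; b] D' /\
   (exists2 s, s \in D' & infix [:: hd a eps; hd b (~~ eps)] s) /\
   (exists2 s, s \in D' & infix [:: tl a eps; tl b (~~ eps)] s
                           || infix [:: tl b (~~ eps); tl a eps] s).

Definition pair_at (D : diagram) (i p : nat) (o : bool) (e1 e2 : ep) : Prop :=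
  in_range D i p /\
  (if o then ent D i p = e1 /\ ent D i p.+1 = e2
        else ent D i p = e2 /\ ent D i p.+1 = e1).

(* R3: triangle of arrows x (top->middle), y (top->bottom), z (middle->bottom);
   the three pairs of adjacent endpoints are all swapped.  The sign condition
   (derived from the planar picture) is
     eps_x eps_y = o_M o_B   and   eps_x eps_z = - o_T o_B,
   where o_T : t_y before t_x, o_M : h_x before t_z, o_B : h_y before h_z. *)
Definition R3move (D D' : diagram) : Prop :=
  exists (x y z : nat) (ex ey ez oT oM oB : bool) (iT pT iM pM iB pB : nat),
    uniq [:: x; y; z] /\
    pair_at D iT pT oT (tl y ey) (tl x ex) /\
    pair_at D iM pM oM (hd x ex) (tl z ez) /\
    pair_at D iB pB oB (hd y ey) (hd z ez) /\
    (ex == ey) = (oM == oB) /\ (ex == ez) = (oT != oB) /\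
    D' = swap_adj (swap_adj (swap_adj D iT pT) iM pM) iB pB.

Definition OCmove (D D' : diagram) : Prop :=
  exists i p, in_range D i p /\ ~~ is_head (ent D i p) /\
    ~~ is_head (ent D i p.+1) /\ D' = swap_adj D i p.

Definition relabel (D D' : diagram) : Prop :=
  exists f : nat -> nat, injective f /\
    D' = map (map (fun e : ep => ((f (lab e), is_head e), esign e))) D.

Definition Vn_move (n : nat) (D D' : diagram) : Prop :=
  exists (L : seq nat) (eps : bool), uniq L /\ size L = n /\
    D = remove_labs L D' /\
    (exists2 s, s \in D' & infix [seq hd a eps | a <- L] s) /\
    (exists2 s, s \in D' & infix [seq tl a eps | a <- L] s).

(* self-crossing virtualization: remove an arrow with both endpoints on the
   same strand (= same component of a string link) *)
Definition sv_move (D D' : diagram) : Prop :=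
  exists a eps, D = remove_labs [:: a] D' /\
    exists2 s, s \in D' & (tl a eps \in s) && (hd a eps \in s).

Definition Vn_sv_step (n : nat) (D D' : diagram) : Prop :=
  wf D /\ wf D' /\
  (R1move D D' \/ R2move D D' \/ R3move D D' \/ OCmove D D' \/ relabel D D'
   \/ Vn_move n D D' \/ sv_move D D').

Definition Vn_sv_equiv (n : nat) : diagram -> diagram -> Prop :=
  clos_refl_sym_trans diagram (Vn_sv_step n).

Local Open Scope ring_scope.
(* words in the free group on alpha_0..alpha_{m-1}: (generator, inverted?) *)
Definition word := seq (nat * bool).
Definition winv (w : word) : word := rev [seq (x.1, ~~ x.2) | x <- w].

Definition heads (D : diagram) (k : nat) : seq ep :=
  filter is_head (nth [::] D k).

(* (strand, arc index) of the over-arc at the tail of arrow a; arcs of a strand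
   are numbered 0,1,... and a new arc starts after each head (undercrossing) *)
Definition tail_loc (D : diagram) (a : nat) : nat * nat :=
  let k := find (fun s => has (fun e : ep => e.1 == (a, false)) s) D in
  let s := nth [::] D k in
  let p := find (fun e : ep => e.1 == (a, false)) s in
  (k, count is_head (take p s)).

Definition uword (D : diagram) (f : nat -> nat -> word) (e : ep) : word :=
  let kl := tail_loc D (lab e) in
  if esign e then f kl.1 kl.2 else winv (f kl.1 kl.2).

(* arcw D p k l : depth-p approximation (in the free group, correct modulo the
   (p+2)-nd lower central series term) of the image of arc l of strand k,
   obtained by iterating a_{k,l} = v_{k,l}^{-1} a_{k,0} v_{k,l} *)
Fixpoint arcw (D : diagram) (p k l : nat) : word :=
  match p with
  | 0 => [:: (k, false)]
  | p'.+1 =>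
      let v := flatten [seq uword D (arcw D p') e | e <- take l (heads D k)] in
      winv v ++ (k, false) :: v
  end.

Definition vword (D : diagram) (p k l : nat) : word :=
  flatten [seq uword D (arcw D p) e | e <- take l (heads D k)].

Definition sgn (b : bool) : int := if b then 1 else -1.

(* the exponent s making the total exponent of component-i generators zero *)
Definition longitude_exp (D : diagram) (i : nat) : int :=
  - \sum_(e <- heads D i | (tail_loc D (lab e)).1 == i) sgn (esign e).

Definition gen_pow (i : nat) (s : int) : word :=
  match s with
  | Posz k => nseq k (i, false)
  | Negz k => nseq k.+1 (i, true)
  end.

Definition longitude (D : diagram) (p i : nat) : word :=
  gen_pow i (longitude_exp D i) ++ vword D p i (size (heads D i)).

(* Magnus expansion: E(alpha_i) = 1 + X_i, E(alpha_i^-1) = sum_t (-X_i)^t *)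
Definition letter_coef (x : nat * bool) (M : seq nat) : int :=
  if x.2 then (if all (pred1 x.1) M then (-1) ^+ size M else 0)
  else (if M == [::] then 1 else if M == [:: x.1] then 1 else 0).

(* coefficient of X_{M_1}...X_{M_k} in E(w) *)
Fixpoint mcoef (w : word) (M : seq nat) : int :=
  match w with
  | [::] => (M == [::])%:R
  | x :: w' => \sum_(t < (size M).+1) letter_coef x (take t M) * mcoef w' (drop t M)
  end.

(* mu^w_D(j_1 ... j_k i), strands numbered from 0; the depth size I is
   more than enough for the coefficient of a degree-k monomial *)
Definition mu_w (D : diagram) (I : seq nat) : int :=
  match I with
  | [::] => 0
  | x :: I' => mcoef (longitude D (size I) (last x I')) (belast x I')
  end.

(* Main.v *)
(** Fix a non-repeated monomial M = X_{j_1} ... X_{j_d} not involving the index i.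
    The coefficient of M in a Magnus expansion is the corner entry of the
    representation of the free group by unitriangular (d+1)x(d+1) matrices over
    Z/n that sends alpha_k to 1 + N_k, where N_k is the elementary matrix
    E_{s,s+1} if j_s = k and 0 if k does not occur in M.  Since N_k g N_k = 0 for
    upper triangular g, conjugates of the image of alpha_k commute and are killed
    by the exponent n, and alpha_i acts trivially.  A diagram has exactly one
    colouring of its arcs by unitriangular matrices that satisfies the Wirtinger
    relations and starts with 1 + N_k on strand k: conjugation is contracting for
    the superdiagonal filtration, so the words [arcw] stabilise to it.  Every
    move transports colourings and preserves the product of the over-arc colours
    along strand i, which is the image of the longitude: self-crossings drop out
    since conjugates of alpha_k commute, and V^n-moves since n-th powers are
    trivial. *)
Require Import Defs.
From mathcomp Require Import all_boot all_order all_algebra.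
Set Implicit Arguments.
Unset Strict Implicit.
Unset Printing Implicit Defensive.
Import GRing.Theory.

(** * Unitriangular matrices and the superdiagonal filtration *)

Section Unitriangular.
Context (R : comUnitRingType) (d : nat).
Local Open Scope ring_scope.
Local Notation A := 'M[R]_d.+1.
Implicit Types (a b g h : A).

(** Level 0 is upper triangular, level 1 strictly upper triangular; levels add under products, and
    level d + 1 contains only 0. *)
Definition filt (j : nat) (a : A) : Prop :=
  forall s t : 'I_d.+1, (t < s + j)%N -> a s t = 0.

Lemma filtW j j' a : (j' <= j)%N -> filt j a -> filt j' a.
Proof. by move=> le_j fa s t lt; apply: fa; apply: leq_trans lt _; rewrite leq_add2l. Qed.

Lemma filt0 j : filt j 0.
Proof. by move=> s t _; rewrite mxE. Qed.

Lemma filt1 : filt 0 1.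
Proof.
move=> s t; rewrite addn0 => lt; rewrite mxE; case: eqP => // e.
by move: lt; rewrite e ltnn.
Qed.

Lemma filtD j a b : filt j a -> filt j b -> filt j (a + b).
Proof. by move=> fa fb s t lt; rewrite mxE fa ?fb ?addr0. Qed.

Lemma filtN j a : filt j a -> filt j (- a).
Proof. by move=> fa s t lt; rewrite mxE fa ?oppr0. Qed.

Lemma filtB j a b : filt j a -> filt j b -> filt j (a - b).
Proof. by move=> fa fb; apply: filtD => //; apply: filtN. Qed.

Lemma filtM i j a b : filt i a -> filt j b -> filt (i + j) (a * b).
Proof.
move=> fa fb s t lt; rewrite mxE big1 // => u _.
case: (ltnP u (s + i)) => [/fa -> | le_u]; first by rewrite mul0r.
rewrite fb ?mulr0 //; apply: leq_trans lt _.
by rewrite addnA leq_add2r.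
Qed.

Lemma filt_eq0 a : filt d.+1 a -> a = 0.
Proof.
move=> fa; apply/matrixP => s t; rewrite fa ?mxE //.
by apply: leq_trans (ltn_ord t) _; rewrite leq_addl.
Qed.

(** The condition is symmetric in [a] and its inverse, so closure under inversion is immediate and
    no Neumann series is summed. *)
Definition unitri (a : A) : Prop :=
  [/\ a \is a GRing.unit, filt 1 (a - 1) & filt 1 (a^-1 - 1)].

Lemma unitri_unit a : unitri a -> a \is a GRing.unit. Proof. by case. Qed.

Lemma unitri_filt a : unitri a -> filt 0 a.
Proof.
case=> _ /(@filtW _ 0 _ isT) fa _.
by rewrite -[a](subrK 1); apply: filtD => //; apply: filt1.
Qed.

Lemma unitriV a : unitri a -> unitri a^-1.
Proof. by case=> ua fa fv; split; rewrite ?unitrV ?invrK. Qed.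

Lemma unitri1 : unitri 1.
Proof. by split; rewrite ?unitr1 // ?invr1 subrr; apply: filt0. Qed.

Lemma unitriM a b : unitri a -> unitri b -> unitri (a * b).
Proof.
suff key g h : unitri g -> unitri h -> filt 1 (g * h - 1).
  move=> Ua Ub; have [ua ub] := (unitri_unit Ua, unitri_unit Ub).
  split; [by rewrite unitrMl | exact: key |].
  by rewrite invrM //; apply: key; apply: unitriV.
move=> [_ fg _] Uh; have [_ fh _] := Uh.
have -> : g * h - 1 = (g - 1) * h + (h - 1).
  by rewrite mulrBl mul1r addrA subrK.
by apply: filtD => //; rewrite -[1%N]addn0; apply: filtM => //; apply: unitri_filt.
Qed.

Lemma unitri_sub a b : unitri a -> unitri b -> filt 1 (a - b).
Proof.
move=> [_ fa _] [_ fb _]; have -> : a - b = (a - 1) - (b - 1) by rewrite opprB addrA subrK.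
exact: filtB.
Qed.

Definition conjm (y g : A) : A := g^-1 * y * g.

Lemma unitri_conjm y g : unitri y -> unitri g -> unitri (conjm y g).
Proof. by move=> Uy Ug; do 2?apply: unitriM => //; apply: unitriV. Qed.

Definition pw (b : bool) (g : A) : A := if b then g else g^-1.

Lemma unitri_pw (b : bool) g : unitri g -> unitri (pw b g).
Proof. by case: b => //; apply: unitriV. Qed.

Lemma pwN (b : bool) g : pw (~~ b) g = (pw b g)^-1.
Proof. by case: b; rewrite /pw //= invrK. Qed.

Lemma pw_conjm (b : bool) y g : y \is a GRing.unit -> g \is a GRing.unit ->
  pw b (conjm y g) = conjm (pw b y) g.
Proof.
case: b => //= uy ug; rewrite /conjm /= invrM ?unitrMl ?unitrV //.
by rewrite invrM ?unitrV // invrK mulrA.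
Qed.

Lemma conjm_mul y g h : g \is a GRing.unit -> h \is a GRing.unit ->
  conjm y (g * h) = conjm (conjm y g) h.
Proof. by move=> ug uh; rewrite /conjm invrM // !mulrA. Qed.

Lemma filt_inv_sub j a b :
  unitri a -> unitri b -> filt j (a - b) -> filt j (a^-1 - b^-1).
Proof.
move=> Ua Ub fab.
have -> : a^-1 - b^-1 = - (a^-1 * (a - b) * b^-1).
  rewrite mulrBr mulVr ?unitri_unit // mulrBl mul1r mulrK ?unitri_unit //.
  by rewrite opprB.
apply: filtN; rewrite -[j]addn0; apply: filtM; last exact: unitri_filt (unitriV Ub).
by rewrite -[j]add0n; apply: filtM => //; apply: unitri_filt (unitriV Ua).
Qed.

Lemma filt_pw_sub j (s : bool) a b :
  unitri a -> unitri b -> filt j (a - b) -> filt j (pw s a - pw s b).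
Proof. by case: s => //; apply: filt_inv_sub. Qed.

Lemma unitri_prod (T : Type) (s : seq T) (P : pred T) (f : T -> A) :
  (forall e, unitri (f e)) -> unitri (\prod_(e <- s | P e) f e).
Proof. by move=> Uf; elim/big_ind: _ => //; [apply: unitri1 | apply: unitriM]. Qed.

Lemma filt_prod_sub j (T : eqType) (s : seq T) (f g : T -> A) :
  (forall e, unitri (f e)) -> (forall e, unitri (g e)) ->
  {in s, forall e, filt j (f e - g e)} ->
  filt j (\prod_(e <- s) f e - \prod_(e <- s) g e).
Proof.
move=> Uf Ug; elim: s => [|e s IH] fg; first by rewrite !big_nil subrr; apply: filt0.
rewrite !big_cons; set F := \prod_(_ <- s) f _; set G := \prod_(_ <- s) g _.
have -> : f e * F - g e * G = (f e - g e) * F + g e * (F - G).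
  by rewrite mulrBl mulrBr addrA subrK.
apply: filtD.
  rewrite -[j]addn0; apply: filtM; first by apply: fg; rewrite mem_head.
  by apply: unitri_filt; apply: unitri_prod.
rewrite -[j]add0n; apply: filtM; first exact: unitri_filt.
by apply: IH => x xs; apply: fg; rewrite inE xs orbT.
Qed.

(** Conjugation fixes the summand 1 of y, and the remaining part [y - 1] contributes one level of
    its own. This gain makes the iteration behind [arcw] contracting. *)
Lemma filt_conjm_sub j y a b : filt 1 (y - 1) ->
  unitri a -> unitri b -> filt j (a - b) -> filt j.+1 (conjm y a - conjm y b).
Proof.
move=> fy Ua Ub fab.
have conjE g : unitri g -> conjm y g = 1 + g^-1 * (y - 1) * g.
  move=> Ug; rewrite /conjm mulrBr mulrBl mulr1 mulVr ?unitri_unit //.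
  by rewrite addrCA subrr addr0.
rewrite !conjE //; move: (y - 1) fy => N fy.
have -> : 1 + a^-1 * N * a - (1 + b^-1 * N * b)
   = (a^-1 - b^-1) * N * a + b^-1 * N * (a - b).
  by rewrite mulrBr !mulrBl opprD addrACA subrr add0r addrA subrK.
apply: filtD.
  rewrite -addn1 -[(j + 1)%N]addn0; apply: filtM; last exact: unitri_filt.
  by apply: filtM => //; apply: filt_inv_sub.
rewrite -add1n; apply: filtM => //; rewrite -[1%N]add0n; apply: filtM => //.
by apply: unitri_filt (unitriV Ub).
Qed.

End Unitriangular.

(** * The Magnus expansion as a matrix representation *)

Section Magnus.
Context (R : comUnitRingType) (M : seq nat).
Hypothesis uniqM : uniq M.
Local Open Scope ring_scope.
Local Notation d := (size M).
Local Notation A := 'M[R]_d.+1.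

(** In the last row s = d the default value of [nth] is harmless: no column has index d + 1. *)
Definition nilm (k : nat) : A :=
  \matrix_(s, t) ((t == s.+1 :> nat) && (nth 0%N M s == k))%:R.
Definition gen (k : nat) : A := 1 + nilm k.
Definition letter (z : nat * bool) : A := pw (~~ z.2) (gen z.1).
Definition rho (w : word) : A := \prod_(z <- w) letter z.

Lemma filt_nilm k : filt 1 (nilm k).
Proof.
move=> s t lt; rewrite mxE; case: eqP => // e.
by move: lt; rewrite e addn1 ltnn.
Qed.

(* The only nonzero entry of [nilm k] sits at some (s, s+1), since M is
   non-repeated, and the (s+1, s) entry of g is below the diagonal. *)
Lemma nilm_mul_nilm k g : filt 0 g -> nilm k * g * nilm k = 0.
Proof.
move=> fg; apply/matrixP => s t; rewrite !mxE big1 // => v _.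
rewrite [nilm k v t]mxE; case: andP => [[/eqP tv /eqP Mv] | _]; last by rewrite mulr0.
rewrite mulr1 mxE big1 // => u _.
rewrite mxE; case: andP => [[/eqP us /eqP Ms] | _]; last by rewrite mul0r.
rewrite mul1r fg // addn0 us ltnS.
have ltv : (v < d)%N by have := ltn_ord t; rewrite tv ltnS.
have lts : (s < d)%N by have := ltn_ord u; rewrite us ltnS.
by move/eqP: Ms; rewrite -Mv nth_uniq // => /eqP ->.
Qed.

Lemma nilm_sq k : nilm k * nilm k = 0.
Proof. by rewrite -[X in X * _]mulr1 nilm_mul_nilm //; apply: filt1. Qed.

Lemma genVl k : (1 - nilm k) * gen k = 1.
Proof. by rewrite mulrBl mul1r mulrDr mulr1 nilm_sq addr0 addrK. Qed.

Lemma genVr k : gen k * (1 - nilm k) = 1.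
Proof. by rewrite mulrBr mulr1 mulrDl mul1r nilm_sq addr0 addrK. Qed.

Lemma gen_unit k : gen k \is a GRing.unit.
Proof. by apply/unitrP; exists (1 - nilm k); rewrite genVl genVr. Qed.

Lemma genV k : (gen k)^-1 = 1 - nilm k.
Proof. by rewrite -[RHS](mulrK (gen_unit k)) genVl mul1r. Qed.

Lemma unitri_gen k : unitri (gen k).
Proof.
split; first exact: gen_unit.
  by rewrite /gen addrC addKr; apply: filt_nilm.
by rewrite genV addrAC subrr add0r; apply: filtN; apply: filt_nilm.
Qed.

Lemma gen_notin k : k \notin M -> gen k = 1.
Proof.
move=> kM; rewrite /gen (_ : nilm k = 0) ?addr0 //; apply/matrixP => s t.
rewrite !mxE; case: andP => // -[/eqP ts /eqP Mk]; case/negP: kM.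
by rewrite -Mk mem_nth //; have := ltn_ord t; rewrite ts ltnS.
Qed.

Lemma conjm_genE k g : unitri g -> conjm (gen k) g = 1 + conjm (nilm k) g.
Proof.
by move=> Ug; rewrite /conjm mulrDr mulrDl mulr1 mulVr ?unitri_unit.
Qed.

(** The products of [nilm k] with its conjugate vanish in both orders. This is the defining relation
    of the reduced free group: each generator commutes with its conjugates. *)
Lemma gen_comm_conj k g : unitri g -> GRing.comm (gen k) (conjm (gen k) g).
Proof.
move=> Ug; rewrite conjm_genE //; apply: commrD; first exact: commr1.
apply/commr_sym/commrD; first exact: commr1.
rewrite /GRing.comm /conjm -!mulrA [nilm k * (g * _)]mulrA nilm_mul_nilm ?mulr0;
  last exact: unitri_filt.
by rewrite !mulrA nilm_mul_nilm ?mul0r //; apply/unitri_filt/unitriV.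
Qed.

(** A conjugate of [nilm k] squares to zero, so the binomial expansion stops after its linear
    term. *)
Lemma conjm_gen_exp k g n : unitri g -> conjm (gen k) g ^+ n = 1 + conjm (nilm k) g *+ n.
Proof.
move=> Ug; elim: n => [|n IH]; first by rewrite expr0 mulr0n addr0.
rewrite exprS IH conjm_genE // mulrDl mul1r mulrDr mulr1 mulrS -addrA.
have -> : conjm (nilm k) g * (conjm (nilm k) g *+ n) = 0.
  rewrite mulrnAr /conjm !mulrA (mulrK (unitri_unit Ug)) -[g^-1 * _ * _]mulrA nilm_sq.
  by rewrite mulr0 mul0r mul0rn.
by rewrite addr0 [_ *+ n + _]addrC.
Qed.

Lemma conjm_gen_exp_char k g n :
  unitri g -> n%:R = 0 :> R -> conjm (gen k) g ^+ n = 1.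
Proof.
move=> Ug n0; rewrite conjm_gen_exp // -scaler_nat.
by rewrite n0 scale0r addr0.
Qed.

Lemma unitri_rho w : unitri (rho w).
Proof. by apply: unitri_prod => z; apply/unitri_pw/unitri_gen. Qed.

Lemma rho_cat w1 w2 : rho (w1 ++ w2) = rho w1 * rho w2.
Proof. exact: big_cat. Qed.

Lemma rho_winv w : rho (winv w) = (rho w)^-1.
Proof.
elim: w => [|z w IH]; first by rewrite /rho big_nil invr1.
rewrite /winv map_cons rev_cons -cats1 rho_cat -/(winv w) IH.
rewrite [rho (z :: w)]big_cons [rho [:: _]]big_seq1.
rewrite invrM ?(unitri_unit (unitri_rho w)) //; last first.
  by apply/unitri_unit/unitri_pw/unitri_gen.
by rewrite /letter /= pwN.
Qed.

Lemma rho_flatten (T : Type) (s : seq T) (f : T -> word) :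
  rho (flatten [seq f e | e <- s]) = \prod_(e <- s) rho (f e).
Proof.
elim: s => [|e s IH]; first by rewrite /rho !big_nil.
by rewrite /= rho_cat IH big_cons.
Qed.

Lemma rho_gen_pow i z : i \notin M -> rho (gen_pow i z) = 1.
Proof.
move=> iM; case: z => k; rewrite /rho big_seq big1 // => x;
  by move=> /nseqP [-> _]; rewrite /letter gen_notin //= invr1.
Qed.

(** On non-repeated monomials the powers X^t with t > 1 in the expansion of an inverse never
    contribute, so a letter acts as 1 + X or 1 - X. *)
Lemma mcoef_cons_uniq z w (L : seq nat) : uniq L ->
  mcoef (z :: w) L =
    mcoef w L + (if L is y :: L' then (if y == z.1 then sgn (~~ z.2) else 0) * mcoef w L' else 0).
Proof.
have l0 : letter_coef z [::] = 1 by rewrite /letter_coef /= expr0 if_same.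
case: L => [_|y L].
  by rewrite /= big_ord_recl big_ord0 /= l0 mul1r addr0.
move=> uyL; rewrite /= big_ord_recl /= l0 mul1r; congr (_ + _).
rewrite big_ord_recl /= take0 drop0 big1 ?addr0 => [|t _].
  congr (_ * _); rewrite /letter_coef /sgn /= andbT eqseq_cons andbT.
  by case: z.2; case: eqP => //=; rewrite expr1.
(* The remaining prefixes have length at least two; a nonzero coefficient would force equal entries,
   against [uniq]. *)
rewrite /bump /= !add1n; case: L uyL t => [|y' L] uyL t; first by case: t.
rewrite /letter_coef /= eqseq_cons andbF.
suff -> : [&& y == z.1, y' == z.1 & all (pred1 z.1) (take t L)] = false.
  by rewrite if_same mul0r.
apply/negP => /and3P[/eqP yz /eqP y'z _].
by move: uyL; rewrite /= yz y'z mem_head.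
Qed.

(** The last column is followed in all rows, row s holding the coefficient of the suffix of M from
    s. Multiplying by a letter on the left adds plus or minus row s + 1 to row s when M_s is its
    generator, which is the recursion of [mcoef_cons_uniq]. *)
Lemma rho_mcoef w (s : 'I_d.+1) : rho w s ord_max = (mcoef w (drop s M))%:~R.
Proof.
elim: w s => [|z w IH] s.
  rewrite /rho big_nil mxE /= -(inj_eq val_inj) /=.
  rewrite -size_eq0 size_drop subn_eq0 eqn_leq -ltnS ltn_ord /=.
  by case: (d <= s)%N; rewrite ?mulr0z ?mulr1z.
have letE : letter z = 1 + (sgn (~~ z.2))%:~R *: nilm z.1.
  rewrite /letter; case: z.2 => /=; last by rewrite mulr1z scale1r.
  by rewrite genV mulrNz mulr1z scaleN1r.
rewrite mcoef_cons_uniq ?drop_uniq // rmorphD /= -IH {1}/rho big_cons letE mulrDl mul1r.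
rewrite mxE; congr (_ + _); rewrite -scalerAl mxE.
rewrite -/(rho w) mxE; case: (ltnP s d) => [lts | ges].
  rewrite (drop_nth 0%N lts).
  have ltS : (s.+1 < d.+1)%N by [].
  rewrite (bigD1 (Ordinal ltS)) //= big1 ?addr0 => [|u neu].
    rewrite mxE eqxx /= IH /= mulrA [in RHS]rmorphM /=; congr (_ * _).
    by case: ifP => _; rewrite ?mulr1 ?mulr0 ?mulr0z.
  rewrite mxE; case: eqP => [e|]; last by rewrite mul0r.
  by case/eqP: neu; apply: val_inj.
rewrite drop_oversize // big1 ?mulr0 ?mulr0z // => u _.
rewrite mxE; case: eqP => [e|]; last by rewrite mul0r.
by have := ltn_ord u; rewrite e ltnS ltnNge ges.
Qed.

End Magnus.

(** * Positions of endpoints in Gauss diagrams and adjacent swaps *)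

Section UniqueKeys.

Lemma head_key (e : ep) : is_head e -> e.1 = (lab e, true).
Proof. by case: e => [[a b] sg]; rewrite /is_head /lab /= => ->. Qed.

(** The uniqueness half of [wf], read by strand index; it is all that is tracked for the
    intermediate diagrams of an R3 move. *)
Definition ukeys (D : diagram) : Prop :=
  (forall k, uniq [seq e.1 | e <- nth [::] D k]) /\
  (forall k k' (e e' : ep), e \in nth [::] D k -> e' \in nth [::] D k' ->
     e.1 = e'.1 -> k = k').

Lemma mem_nth_flatten (D : diagram) k e : e \in nth [::] D k -> e \in flatten D.
Proof.
case: (ltnP k (size D)) => [ltk|gek]; last by rewrite nth_default.
by move=> ek; apply/flattenP; exists (nth [::] D k) => //; apply: mem_nth.
Qed.

Lemma mem_flatten_nth (D : diagram) e : e \in flatten D -> exists k, e \in nth [::] D k.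
Proof. by case/flattenP => s /(nthP [::]) [k _ <-] es; exists k. Qed.

Lemma wf_ukeys D : wf D -> ukeys D.
Proof.
case=> + _; elim: D => [|s D IH]; first by move=> _; split=> [k|k k' e e']; rewrite nth_nil.
rewrite /= map_cat cat_uniq => /and3P[us /hasPn sD /IH [u1 u2]].
have sep (e e' : ep) k : e \in s -> e' \in nth [::] D k -> e.1 <> e'.1.
  move=> es /mem_nth_flatten e'D ee'; have /negP := sD _ (map_f fst e'D); apply.
  by rewrite -ee' /=; apply: map_f.
split=> [[|k]|[|k] [|k'] e e'] //=.
- by move=> es e'D /(sep _ _ _ es e'D).
- by move=> eD e's /esym /(sep _ _ _ e's eD).
by move=> eD e'D ee'; congr S; apply: u2 eD e'D ee'.
Qed.

Lemma ukeys_cat D k s1 (e : ep) s2 : ukeys D -> nth [::] D k = s1 ++ e :: s2 ->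
  e.1 \notin [seq e'.1 | e' <- s1] /\ e.1 \notin [seq e'.1 | e' <- s2].
Proof.
case=> /(_ k) + _ E; rewrite E map_cat cat_uniq /= => /and3P[_ /norP[-> _]].
by case/andP.
Qed.

(** Since keys are unique, both searches in [tail_loc] stop at the given occurrence. *)
Lemma tail_locE D k s1 a sg s2 : ukeys D -> nth [::] D k = s1 ++ tl a sg :: s2 ->
  tail_loc D a = (k, count is_head s1).
Proof.
move=> uD E; rewrite /tail_loc.
set p := fun s : seq ep => has (fun e : ep => e.1 == (a, false)) s.
have ek : tl a sg \in nth [::] D k by rewrite E mem_cat mem_head orbT.
have hasD : has p D.
  have ltk : k < size D by rewrite ltnNge; apply/negP => ge; move: ek; rewrite nth_default.
  by apply/hasP; exists (nth [::] D k); [apply: mem_nth | apply/hasP; exists (tl a sg)].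
have -> : find p D = k.
  have /hasP[e es /eqP ea] := nth_find [::] hasD.
  exact: (uD.2 _ _ _ _ es ek).
congr pair; rewrite E find_cat.
have [s1a _] := ukeys_cat uD E.
have -> : has (fun e : ep => e.1 == (a, false)) s1 = false.
  by apply/negP => /hasP[e es1 /eqP ea]; case/negP: s1a; rewrite -[(tl a sg).1]ea map_f.
by rewrite /= eqxx addn0 take_size_cat.
Qed.

Lemma take_count_heads D k s1 s2 : nth [::] D k = s1 ++ s2 ->
  take (count is_head s1) (heads D k) = filter is_head s1.
Proof. by move=> E; rewrite /heads E filter_cat take_size_cat // size_filter. Qed.

Lemma nth_remove_labs L D k :
  nth [::] (remove_labs L D) k = filter (fun e => lab e \notin L) (nth [::] D k).
Proof.
case: (ltnP k (size D)) => [ltk|gek]; first by rewrite (nth_map [::]).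
by rewrite !nth_default ?size_map.
Qed.

Lemma set_nth_cat1 (T : Type) (x0 : T) s1 x y s2 :
  set_nth x0 (s1 ++ x :: s2) (size s1) y = s1 ++ y :: s2.
Proof. by elim: s1 => //= z s1 ->. Qed.

Lemma swap_adjP D i p : in_range D i p ->
  exists s1 s2, nth [::] D i = s1 ++ [:: ent D i p; ent D i p.+1] ++ s2 /\
    forall k, nth [::] (swap_adj D i p) k =
      if k == i then s1 ++ [:: ent D i p.+1; ent D i p] ++ s2 else nth [::] D k.
Proof.
rewrite /in_range => /andP[lti ltp].
set s := nth [::] D i in ltp *; set e1 := ent D i p; set e2 := ent D i p.+1.
have E : s = take p s ++ [:: e1; e2] ++ drop p.+2 s.
  by rewrite /= -(drop_nth ep0 ltp) -(drop_nth ep0 (ltnW ltp)) cat_take_drop.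
exists (take p s), (drop p.+2 s); split=> // k.
have sz : size (take p s) = p by rewrite size_take ltnW.
rewrite /swap_adj nth_set_nth /= -/s; case: ifP => // _.
rewrite -/(ent D i p) -/(ent D i p.+1) -/e1 -/e2.
(* The position p becomes [size s1], the form in which [set_nth_cat1] applies to each of the two
   writes. *)
move: (take p s) (drop p.+2 s) sz E => s1 s2 <- ->.
by rewrite set_nth_cat1 -cat_rcons -(size_rcons s1 e2) set_nth_cat1 cat_rcons.
Qed.

Lemma swap_adj_perm D i p k : in_range D i p ->
  perm_eq (nth [::] (swap_adj D i p) k) (nth [::] D k).
Proof.
case/swap_adjP => s1 [s2 [E ->]]; case: eqP => [->|//].
rewrite E perm_cat2l perm_cat2r -[X in perm_eq X]cat1s -[X in perm_eq _ X]cat1s.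
by rewrite perm_catC.
Qed.

Lemma ukeys_swap D i p : in_range D i p -> ukeys D -> ukeys (swap_adj D i p).
Proof.
move=> rD [u1 u2]; have P k := swap_adj_perm k rD.
split=> [k|k k' e e']; first by rewrite (perm_uniq (perm_map _ (P k))).
by rewrite !(perm_mem (P _)); apply: u2.
Qed.

Lemma in_range_swap D i p j q : in_range D i p ->
  in_range (swap_adj D i p) j q = in_range D j q.
Proof.
move=> rD; rewrite /in_range (perm_size (swap_adj_perm j rD)).
by rewrite size_set_nth; case/andP: rD => lti _; rewrite (maxn_idPr lti).
Qed.

Lemma ent_swap D i p j q : in_range D i p ->
  ent D j q \notin [:: ent D i p; ent D i p.+1] ->
  ent (swap_adj D i p) j q = ent D j q.
Proof.
move=> /andP[lti ltp]; rewrite !inE => /norP[n1 n2].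
rewrite {1}/ent /swap_adj nth_set_nth /=; case: eqP => [E|//].
rewrite nth_set_nth /=; case: eqP => [Eq|_].
  by case/eqP: n2; rewrite E Eq.
rewrite nth_set_nth /=; case: eqP => [Eq|_]; last by rewrite E.
by case/eqP: n1; rewrite E Eq.
Qed.

(** Pairs with different endpoints occupy disjoint positions even on a common strand, so the three
    swaps of an R3 move can be done one at a time. *)
Lemma pair_at_swap D i p o f1 f2 j q o' e1 e2 :
  pair_at D i p o f1 f2 -> pair_at D j q o' e1 e2 ->
  e1 \notin [:: f1; f2] -> e2 \notin [:: f1; f2] ->
  pair_at (swap_adj D i p) j q o' e1 e2.
Proof.
move=> [rD F] [rj E] n1 n2; split; first by rewrite in_range_swap.
have n (e : ep) : e \notin [:: f1; f2] -> e \notin [:: ent D i p; ent D i p.+1].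
  by case: o F => -[-> ->] //; rewrite !inE orbC.
by case: o' E => -[E1 E2]; rewrite !ent_swap // ?E1 ?E2 //; apply: n.
Qed.

End UniqueKeys.

(** * Colourings of arcs and holonomy along strands *)

Section Colourings.
Context (R : comUnitRingType) (M : seq nat).
Hypothesis uniqM : uniq M.
Local Open Scope ring_scope.
Local Notation d := (size M).
Local Notation A := 'M[R]_d.+1.
Local Notation gen := (@gen R M).
Local Notation rho := (@rho R M).
Implicit Types (C : nat * bool -> A) (D : diagram) (y g : A).

Definition headval C (e : ep) : A := pw (esign e) (C e.1).

(** The image of v_{ij}, the product of the signed over-arc generators u at the undercrossings met
    along s. *)
Definition holonomy C (s : seq ep) : A := \prod_(e <- s | is_head e) headval C e.

(** Here y is the colour of the initial arc and g accumulates the heads already passed, so the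
    current arc has colour g^-1 y g. *)
Fixpoint strand_ok C y g (s : seq ep) : Prop :=
  match s with
  | [::] => True
  | e :: s' =>
      if is_head e then strand_ok C y (g * headval C e) s'
      else C e.1 = conjm y g /\ strand_ok C y g s'
  end.

(* The colour of a tail is the Wirtinger image of the arc it lies on, the colour
   of a head that of the over-arc.  The two are kept apart because the
   intermediate steps of an R3 move respect only the strand conditions. *)
Definition strands_ok C D : Prop :=
  (forall x, unitri (C x)) /\ (forall k, strand_ok C (gen k) 1 (nth [::] D k)).

Definition colouring D C : Prop :=
  strands_ok C D /\ forall a, C (a, true) = C (a, false).

Lemma unitri_holonomy C s : (forall x, unitri (C x)) -> unitri (holonomy C s).
Proof. by move=> UC; apply: unitri_prod => e; apply: unitri_pw. Qed.

Lemma holonomy_cat C s1 s2 : holonomy C (s1 ++ s2) = holonomy C s1 * holonomy C s2.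
Proof. exact: big_cat. Qed.

Lemma strand_ok_cat C y g s1 s2 :
  strand_ok C y g (s1 ++ s2) <->
  strand_ok C y g s1 /\ strand_ok C y (g * holonomy C s1) s2.
Proof.
elim: s1 g => [|e s1 IH] g; first by rewrite /holonomy big_nil mulr1 /=; tauto.
rewrite /holonomy big_cons /=; case: (is_head e).
  by rewrite mulrA; exact: IH.
by have := IH g; rewrite /holonomy; tauto.
Qed.

Lemma strand_ok_eq C C' y g s : {in s, forall e : ep, C' e.1 = C e.1} ->
  strand_ok C y g s -> strand_ok C' y g s.
Proof.
elim: s g => //= e s IH g CC'.
have Ce : C' e.1 = C e.1 by apply: CC'; rewrite mem_head.
have {}IH g' := IH g' (fun x xs => CC' x (mem_behead (s := e :: s) xs)).
by rewrite /headval Ce; case: (is_head e) => [/IH //|[-> /IH]].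
Qed.

Lemma holonomy_eq C C' s : {in s, forall e : ep, C' e.1 = C e.1} ->
  holonomy C' s = holonomy C s.
Proof.
move=> CC'; rewrite /holonomy big_seq_cond [RHS]big_seq_cond.
by apply: eq_bigr => e /andP[es _]; rewrite /headval CC'.
Qed.

Lemma strand_ok_tail C y g s1 a sg s2 : strand_ok C y g (s1 ++ tl a sg :: s2) ->
  C (a, false) = conjm y (g * holonomy C s1).
Proof. by case/strand_ok_cat => _ /= []. Qed.

Lemma strand_okP C y g s :
  (forall s1 a sg s2, s = s1 ++ tl a sg :: s2 ->
     C (a, false) = conjm y (g * holonomy C s1)) -> strand_ok C y g s.
Proof.
elim: s g => //= e s IH g tail_eq; case: ifP => he.
  apply: IH => s1 a sg s2 E; rewrite (tail_eq (e :: s1) a sg s2) ?E //.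
  by rewrite /holonomy big_cons he mulrA.
move: e he tail_eq => [[a b] sg] /= he; rewrite /is_head /= in he; rewrite he => tail_eq; split.
  by rewrite (tail_eq [::] a sg s) // /holonomy big_nil mulr1.
apply: IH => s1 a' sg' s2 E; rewrite (tail_eq (tl a sg :: s1) a' sg' s2) ?E //.
by rewrite /holonomy big_cons.
Qed.

(** * Existence of a colouring, and its uniqueness on the heads of the diagram *)

Definition arc_value D p a : A := rho (arcw D p (tail_loc D a).1 (tail_loc D a).2).

Lemma rho_vword D p k l :
  rho (vword D p k l) = \prod_(e <- take l (heads D k)) pw (esign e) (arc_value D p (lab e)).
Proof.
rewrite rho_flatten; apply: eq_bigr => e _; rewrite /uword /arc_value.
by case: (esign e); rewrite //= rho_winv.
Qed.

Lemma rho_arcwS D p k l : rho (arcw D p.+1 k l) = conjm (gen k) (rho (vword D p k l)).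
Proof.
rewrite /= rho_cat rho_winv // /conjm -mulrA; congr (_ * _).
by rewrite [LHS]big_cons.
Qed.

Lemma unitri_arc_value D p a : unitri (arc_value D p a).
Proof. exact: unitri_rho. Qed.

Lemma filt_gen k : filt 1 (gen k - 1).
Proof. by have [] := unitri_gen R uniqM k. Qed.

(** Unitriangular matrices agree up to level 1, and every further iteration gains a level by
    [filt_conjm_sub]. *)
Lemma arcw_stable D p k l : filt p.+1 (rho (arcw D p.+1 k l) - rho (arcw D p k l)).
Proof.
elim: p k l => [|p IH] k l; first by apply: unitri_sub; apply: unitri_rho.
rewrite !rho_arcwS; apply: filt_conjm_sub; try exact: unitri_rho; first exact: filt_gen.
rewrite !rho_vword; apply: filt_prod_sub => [e|e|e _].
- exact/unitri_pw/unitri_arc_value.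
- exact/unitri_pw/unitri_arc_value.
by apply: filt_pw_sub; [exact: unitri_arc_value | exact: unitri_arc_value | exact: IH].
Qed.

(** At depth d another iteration changes nothing, since level d + 1 is zero; the values then satisfy
    the Wirtinger relations exactly. *)
Lemma arc_value_colouring D : wf D -> colouring D (fun x => arc_value D d x.1).
Proof.
move=> wfD; have uD := wf_ukeys wfD.
split=> //; split=> [x|k]; first exact: unitri_arc_value.
apply: strand_okP => s1 a sg s2 E; rewrite mul1r /= {1}/arc_value (tail_locE uD E) /=.
have := @arcw_stable D d k (count is_head s1) => /filt_eq0 /eqP.
rewrite subr_eq0 => /eqP <-; rewrite rho_arcwS rho_vword (take_count_heads E).
by rewrite big_filter.
Qed.

Lemma filt_headval_sub D C p (s : seq ep) :
  (forall x, unitri (C x)) ->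
  {in s, forall e, filt p (C e.1 - arc_value D p.-1 (lab e))} ->
  filt p (\prod_(e <- s) headval C e
          - \prod_(e <- s) pw (esign e) (arc_value D p.-1 (lab e))).
Proof.
move=> UC fC; apply: filt_prod_sub => [e|e|e es].
- exact: unitri_pw.
- exact/unitri_pw/unitri_arc_value.
by apply: filt_pw_sub; [ | exact: unitri_arc_value | exact: fC].
Qed.

(** By [wf] each head has a matching tail, whose colour is a generator conjugated by the heads
    before it. Agreement of those up to one level gives agreement of the conjugates up to the next.
    Only endpoints of D are compared, as C is unconstrained elsewhere. *)
Lemma colouring_head_approx D C p : wf D -> colouring D C ->
  forall e : ep, e \in flatten D -> is_head e ->
  filt p.+1 (C e.1 - arc_value D p (lab e)).
Proof.
move=> wfD [[UC okC] Cht]; have uD := wf_ukeys wfD.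
elim: p => [|p IH] e eD he; first exact: unitri_sub (UC _) (unitri_arc_value _ _ _).
have := wfD.2 _ eD; rewrite he /= => /mem_flatten_nth [k].
move=> tk; have [s1 [s2 E]] : exists s1 s2, nth [::] D k = s1 ++ tl (lab e) (esign e) :: s2.
  by case/splitPr: tk => s1 s2; exists s1, s2.
have -> : C e.1 = C (lab e, false).
  by rewrite head_key.
have := okC k; rewrite E => /strand_ok_tail; rewrite mul1r => ->.
rewrite /arc_value (tail_locE uD E) rho_arcwS.
apply: filt_conjm_sub; [exact: filt_gen | exact: unitri_holonomy | exact: unitri_rho |].
rewrite rho_vword (take_count_heads E) /holonomy -big_filter.
apply: (@filt_headval_sub D C p.+1) => // e'; rewrite mem_filter => /andP[he' e's1].
by apply: IH => //; apply: (@mem_nth_flatten _ k); rewrite E mem_cat e's1.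
Qed.

Lemma colouring_holonomy D C p i : wf D -> colouring D C -> (d <= p)%N ->
  holonomy C (nth [::] D i) = rho (vword D p i (size (heads D i))).
Proof.
move=> wfD colC led; apply/eqP; rewrite -subr_eq0; apply/eqP/filt_eq0.
apply: (@filtW _ _ p.+1) => //; rewrite rho_vword take_size /heads /holonomy -big_filter.
apply: (@filt_headval_sub D C p.+1); first by case: colC => -[].
move=> e; rewrite mem_filter => /andP[he ei].
exact: colouring_head_approx wfD colC _ (mem_nth_flatten ei) he.
Qed.

(** * Transport of colourings along the moves *)

(** Producing some colouring of D' is enough, because by [colouring_holonomy] all colourings of a
    diagram have the same holonomy along strand i. *)
Definition carries (i : nat) D D' : Prop :=
  forall C, colouring D C -> exists2 C', colouring D' C' &
    holonomy C (nth [::] D i) = holonomy C' (nth [::] D' i).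

Lemma carries_longitude i p D D' : wf D -> wf D' -> (d <= p)%N -> carries i D D' ->
  rho (vword D p i (size (heads D i))) = rho (vword D' p i (size (heads D' i))).
Proof.
move=> wfD wfD' led car; have colC := arc_value_colouring wfD.
have [C' colC' E] := car _ colC.
by rewrite -(colouring_holonomy _ wfD colC led) E (colouring_holonomy _ wfD' colC' led).
Qed.

(** Deleting a tail merely drops one condition; only heads change the conjugator. *)
Lemma strand_ok_filter C y g (L : seq nat) s : {in s, forall e, is_head e -> lab e \notin L} ->
  strand_ok C y g s -> strand_ok C y g (filter (fun e => lab e \notin L) s).
Proof.
elim: s g => //= e s IH g hL; have {}IH g' := IH g' (fun x xs => hL x (mem_behead (s := e :: s) xs)).
have := hL e (mem_head _ _); case: ifP => he.
  by move=> /(_ isT) -> /= /IH; rewrite he.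
by move=> _ [Ce /IH]; case: ifP => //= _; rewrite he.
Qed.

Lemma holonomy_filter C (L : seq nat) s : {in s, forall e, is_head e -> lab e \notin L} ->
  holonomy C (filter (fun e => lab e \notin L) s) = holonomy C s.
Proof.
move=> hL; rewrite /holonomy big_filter_cond big_seq_cond [RHS]big_seq_cond.
apply: eq_bigl => e; case es: (e \in s) => //=.
by case he: (is_head e); rewrite ?andbF // hL.
Qed.

Lemma ukeys_other_strand D k k' (e : ep) (L : seq nat) : ukeys D -> k != k' ->
  {in L, forall a, exists2 e', e' \in nth [::] D k' & e'.1 = (a, true)} ->
  e \in nth [::] D k -> is_head e -> lab e \notin L.
Proof.
move=> uD nk HL ek he; apply/negP => /HL [e' e'k' e'1].
case/eqP: nk; apply: (uD.2 _ _ _ _ ek e'k').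
by rewrite head_key.
Qed.

(** Consecutive heads with trivial product leave every later conjugator unchanged, so the same C
    colours the smaller diagram. This serves both R2 and V^n-moves. *)
Lemma carries_remove_block i (L : seq nat) D (B : seq ep) : ukeys D ->
  (exists2 s, s \in D & infix B s) -> all is_head B -> map lab B = L ->
  (forall C, colouring D C -> \prod_(e <- B) headval C e = 1) ->
  carries i D (remove_labs L D).
Proof.
move=> uD [_ /(nthP [::]) [k0 ltk0 <-] /infixP [P [Q E]]] hB BL HB C colC.
have {HB} : holonomy C B = 1.
  rewrite -(HB C colC) /holonomy -big_filter; congr bigop; exact/all_filterP.
have [[UC okC] Cht] := colC => holB.
have HL : {in L, forall a, exists2 e', e' \in B & e'.1 = (a, true)}.
  move=> a; rewrite -BL => /mapP [e eB ->]; exists e => //.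
  by rewrite head_key // (allP hB).
have filtB : filter (fun e => lab e \notin L) B = [::].
  by apply/eqP; rewrite -[_ == _]negbK -has_filter; apply/hasPn => e eB; rewrite negbK -BL map_f.
(* By uniqueness of keys all deleted heads lie in B; elsewhere only tails disappear. *)
have [hP hQ] : {in P, forall e, is_head e -> lab e \notin L} /\
               {in Q, forall e, is_head e -> lab e \notin L}.
  have := uD.1 k0; rewrite E !map_cat !cat_uniq => /and4P[_ /hasPn hBP _ /andP[/hasPn hQB _]].
  split=> e es he; apply/negP => /HL [e' e'B e'1].
    have := hBP e'.1; rewrite mem_cat map_f //= => /(_ isT) /negP; apply.
    by rewrite e'1 -head_key // map_f.
  have := hQB e.1 (map_f _ es) => /negP; apply.
  by rewrite head_key // -e'1 /= map_f.
have hk k : k != k0 -> {in nth [::] D k, forall e, is_head e -> lab e \notin L}.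
  move=> nk e; apply: (ukeys_other_strand uD nk) => a /HL [e' e'B e'1].
  by exists e' => //; rewrite E !mem_cat e'B orbT.
exists C.
  split=> //; split=> // k; rewrite nth_remove_labs.
  have [->|nk] := eqVneq k k0; last by apply: strand_ok_filter => //; apply: hk.
  have := okC k0; rewrite E !filter_cat filtB /=.
  case/strand_ok_cat => okP /strand_ok_cat [_]; rewrite holB mulr1 => okQ.
  apply/strand_ok_cat; split; first exact: strand_ok_filter.
  by rewrite holonomy_filter //; apply: strand_ok_filter.
rewrite nth_remove_labs; have [->|nk] := eqVneq i k0; last first.
  by rewrite holonomy_filter //; apply: hk.
by rewrite E !filter_cat filtB /= !holonomy_cat holB mul1r !holonomy_filter.
Qed.

Lemma strands_ok_tails_eq C D (a b : nat) (ea eb : bool) :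
  strands_ok C D -> (exists2 s, s \in D & infix [:: tl a ea; tl b eb] s) ->
  C (a, false) = C (b, false).
Proof.
move=> [UC okC] [_ /(nthP [::]) [k _ <-] /infixP [P [Q E]]].
have := okC k; rewrite E => /strand_ok_cat [_] /=.
by case=> -> [-> _].
Qed.

Lemma strands_ok_tail_conj C D k a sg : strands_ok C D -> tl a sg \in nth [::] D k ->
  exists2 h, unitri h & C (a, false) = conjm (gen k) h.
Proof.
move=> [UC okC]; case/splitPr E: _ / => [P Q]; have := okC k.
rewrite E => /strand_ok_tail ->; exists (1 * holonomy C P) => //.
by rewrite mul1r; apply: unitri_holonomy.
Qed.

(** The adjacent tails lie on one arc, so the two heads carry the same colour with opposite signs
    and cancel. *)
Lemma carries_R2 i D D' : wf D' -> R2move D D' -> carries i D' D.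
Proof.
move=> wfD' [a [b [eps [_ [-> [heads_ab tails_ab]]]]]].
apply: (carries_remove_block i (wf_ukeys wfD') heads_ab) => // C [okC Cht].
have Cab : C (a, false) = C (b, false).
  case: tails_ab => s sD /orP[] st; first exact: strands_ok_tails_eq okC (ex_intro2 _ _ s sD st).
  by apply/esym; apply: strands_ok_tails_eq okC (ex_intro2 _ _ s sD st).
rewrite big_cons big_seq1 /headval /= !Cht Cab pwN divrr //.
by apply/unitri_unit/unitri_pw; case: okC.
Qed.

(** The n tails lie on one arc, so the heads contribute the n-th power of a conjugate of a generator
    or of its inverse, which is 1. *)
Lemma carries_Vn i n D D' : wf D' -> n%:R = 0 :> R -> Vn_move n D D' -> carries i D' D.
Proof.
move=> wfD' n0 [L [eps [_ [szL [-> [heads_L tails_L]]]]]].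
apply: (carries_remove_block i (wf_ukeys wfD') heads_L).
- by apply/allP => e /mapP [a _ ->].
- by rewrite -map_comp map_id.
move=> C [okC Cht]; have [UC _] := okC; rewrite big_map.
case: tails_L => _ /(nthP [::]) [k _ <-] /infixP [P [Q E]].
have CL : {in L, forall a, C (a, false) = conjm (gen k) (holonomy C P)}.
  have := okC.2 k; rewrite E => /strand_ok_cat [_ /strand_ok_cat [+ _]].
  rewrite mul1r; elim: L {szL heads_L E} => //= a L IH [Ca /IH {}IH] b.
  by rewrite inE => /orP[/eqP -> | /IH].
have UP := unitri_holonomy P UC.
rewrite big_seq (eq_bigr (fun=> pw eps (conjm (gen k) (holonomy C P)))) => [|a aL]; last first.
  by rewrite /headval /= Cht CL.
rewrite -big_seq big_const_seq count_predT szL iter_mulr_1; case: (eps) => /=.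
  by rewrite conjm_gen_exp_char.
by rewrite exprVn conjm_gen_exp_char // invr1.
Qed.

(** Conjugating y depends only on the conjugator up to left multiplication by the centraliser of
    y. *)
Lemma strand_ok_comm C y c g s : c \is a GRing.unit -> g \is a GRing.unit ->
  (forall x, unitri (C x)) -> GRing.comm c y ->
  strand_ok C y (c * g) s -> strand_ok C y g s.
Proof.
move=> uc + UC cy; elim: s g => //= e s IH g ug; case: ifP => _.
  by rewrite -mulrA; apply: IH; rewrite unitrMl //; apply/unitri_unit/unitri_pw.
case=> -> /IH oks; split; last exact: oks.
by rewrite conjm_mul // /conjm -(mulrA c^-1) -cy mulKr.
Qed.

(** The deleted head contributes a conjugate of its own strand's generator or of the inverse, which
    does not affect the later colours there. If the strand is i, that contribution is 1, so the
    holonomy is kept as well. *)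
Lemma carries_sv i D D' : i \notin M -> wf D' -> sv_move D D' -> carries i D' D.
Proof.
move=> iM wfD' [a [eps [-> [_ /(nthP [::]) [k0 _ <-] /andP[ta ha]]]]] C colC.
have uD := wf_ukeys wfD'; have [[UC okC] Cht] := colC.
have [h Uh Ca] := strands_ok_tail_conj colC.1 ta.
have [P [Q E]] : exists P Q, nth [::] D' k0 = P ++ hd a eps :: Q.
  by case/splitPr: ha => P Q; exists P, Q.
have [nP nQ] := ukeys_cat uD E.
have hN (s : seq ep) : (a, true) \notin [seq e.1 | e <- s] ->
    {in s, forall e, is_head e -> lab e \notin [:: a]}.
  move=> ns e es he; rewrite inE; apply: contra ns => /eqP <-.
  by rewrite -head_key // map_f.
have hk k : k != k0 -> {in nth [::] D' k, forall e, is_head e -> lab e \notin [:: a]}.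
  move=> nk e; apply: (ukeys_other_strand uD nk) => b; rewrite inE => /eqP ->.
  by exists (hd a eps).
have Ehol : holonomy C (hd a eps :: Q) = pw eps (conjm (gen k0) h) * holonomy C Q.
  by rewrite /holonomy big_cons /= /headval /= Cht Ca.
exists C.
  split=> //; split=> // k; rewrite nth_remove_labs.
  have [->|nk] := eqVneq k k0; last by apply: strand_ok_filter => //; apply: hk.
  have := okC k0; rewrite E filter_cat /= inE eqxx /=.
  case/strand_ok_cat => okP /=; rewrite mul1r /headval /= Cht Ca => okQ.
  apply/strand_ok_cat; split; first by apply: strand_ok_filter => //; apply: hN.
  rewrite mul1r holonomy_filter; last exact: hN.
  apply: strand_ok_filter; first exact: hN.
  set g := holonomy C P in okQ *; have Ug : unitri g := unitri_holonomy P UC.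
  have ug := unitri_unit Ug; have uh := unitri_unit Uh.
  have uy := unitri_unit (unitri_gen R uniqM k0).
  set b := pw eps _ in okQ.
  have Ub : unitri b by apply/unitri_pw/unitri_conjm => //; apply: unitri_gen.
  (* The conjugator g b is rewritten as c g with c = g b g^-1, again a conjugate of the generator or
     of its inverse, so it commutes with the generator. *)
  apply: (@strand_ok_comm C _ (g * b * g^-1)) => //.
  - by apply/unitri_unit/unitriM/unitriV => //; apply: unitriM.
  - have -> : g * b * g^-1 = pw eps (conjm (gen k0) (h * g^-1)).
      rewrite pw_conjm ?unitrMl ?unitrV // conjm_mul ?unitrV // /conjm invrK.
      by rewrite /b pw_conjm.
    apply/commr_sym; case: (eps) => /=; last apply: commrV.
      by apply: gen_comm_conj => //; apply/unitriM/unitriV.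
    by apply: gen_comm_conj => //; apply/unitriM/unitriV.
  by rewrite mulrVK.
rewrite nth_remove_labs; have [ik|nk] := eqVneq i k0; last first.
  by rewrite holonomy_filter //; apply: hk.
rewrite ik E filter_cat /= inE eqxx /= !holonomy_cat Ehol -ik gen_notin // !holonomy_filter; try exact: hN.
by rewrite /conjm mulr1 mulVr ?unitri_unit //; case: (eps); rewrite /= ?invr1 mul1r.
Qed.

Lemma R1_sv D D' : R1move D D' -> sv_move D D'.
Proof.
move=> [a [eps [ED [s sD st]]]]; exists a, eps; split=> //; exists s => //.
by case/orP: st => /infixP [P [Q ->]]; rewrite !mem_cat !inE !eqxx ?orbT.
Qed.

Lemma carries_relabel i D D' : relabel D D' -> carries i D' D.
Proof.
move=> [f [_ ->]] C' [[UC okC] Cht].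
set r := fun e : ep => _ in okC *; pose C := fun x : nat * bool => C' (f x.1, x.2).
have nthE k : nth [::] (map (map r) D) k = map r (nth [::] D k).
  case: (ltnP k (size D)) => [ltk|gek]; first by rewrite (nth_map [::]).
  by rewrite !nth_default ?size_map.
exists C.
  split=> [|a]; last exact: Cht.
  split=> [x|k]; first exact: UC.
  have := okC k; rewrite nthE; elim: (nth [::] D k) (1 : A) => //= -[[a b] sg] s IH g.
  by rewrite /is_head /headval /=; case: b => [/IH|[? /IH]].
rewrite nthE /holonomy big_map; exact: eq_big.
Qed.

(** A local criterion: if the swapped pair keeps its total product, everything after it sees the
    same conjugator, so only the pair itself needs checking. *)
Lemma strands_ok_swap D C C' i p : ukeys D -> in_range D i p -> strands_ok C D ->
  (forall x, unitri (C' x)) ->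
  (forall x, x != (ent D i p).1 -> x != (ent D i p.+1).1 -> C' x = C x) ->
  holonomy C' [:: ent D i p.+1; ent D i p] = holonomy C [:: ent D i p; ent D i p.+1] ->
  (forall g, unitri g -> strand_ok C (gen i) g [:: ent D i p; ent D i p.+1] ->
     strand_ok C' (gen i) g [:: ent D i p.+1; ent D i p]) ->
  strands_ok C' (swap_adj D i p) /\
  forall k, holonomy C' (nth [::] (swap_adj D i p) k) = holonomy C (nth [::] D k).
Proof.
move=> uD rD [UC okC] UC' CC' hol ok12; have [s1 [s2 [E swE]]] := swap_adjP rD.
move: (ent D i p) (ent D i p.+1) CC' hol ok12 E swE => e1 e2 CC' hol ok12 E swE.
have Cs : {in s1, forall e : ep, C' e.1 = C e.1} /\ {in s2, forall e : ep, C' e.1 = C e.1}.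
  have E2 : nth [::] D i = rcons s1 e1 ++ e2 :: s2 by rewrite E cat_rcons.
  have [a1 a2] := ukeys_cat uD E; have [b1 b2] := ukeys_cat uD E2.
  rewrite map_rcons mem_rcons inE negb_or in b1; case/andP: b1 => _ b1.
  rewrite /= inE negb_or in a2; case/andP: a2 => _ a2.
  by split=> e es; apply: CC'; apply/negP => /eqP ee;
    [move: a1 | move: b1 | move: a2 | move: b2]; rewrite -ee map_f.
have Ck k : k != i -> {in nth [::] D k, forall e : ep, C' e.1 = C e.1}.
  move=> nk e ek; apply: CC'; apply/negP => /eqP ee; case/eqP: nk;
    apply: (uD.2 _ _ _ _ ek _ ee); by rewrite E !mem_cat !inE eqxx ?orbT.
split.
  split=> // k; rewrite swE; case: (eqVneq k i) => [->|nk]; last exact: strand_ok_eq (Ck _ nk) (okC k).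
  have := okC i; rewrite E => /strand_ok_cat [ok1 /strand_ok_cat [okp ok2]].
  have hs1 := holonomy_eq Cs.1.
  apply/strand_ok_cat; split; first exact: strand_ok_eq Cs.1 ok1.
  apply/strand_ok_cat; rewrite hs1; split.
    by apply: ok12 okp; rewrite mul1r; apply: unitri_holonomy.
  by rewrite hol; apply: strand_ok_eq Cs.2 ok2.
move=> k; rewrite swE; case: (eqVneq k i) => [->|nk]; last exact: holonomy_eq (Ck _ nk).
by rewrite E !holonomy_cat hol (holonomy_eq Cs.1) (holonomy_eq Cs.2).
Qed.

Lemma carries_OC i D D' : wf D -> OCmove D D' -> carries i D D'.
Proof.
move=> wfD [j [p [rD [/negPf t1 [/negPf t2 ->]]]]] C [okC Cht].
have [||okC' hol] := @strands_ok_swap D C C j p (wf_ukeys wfD) rD okC okC.1 (fun _ _ _ => erefl).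
- by rewrite /holonomy !big_cons !big_nil t1 t2.
- by move=> g _ /=; rewrite t1 t2 => -[? [? _]].
by exists C => //; rewrite hol.
Qed.

Lemma strands_ok_pair C D i p : strands_ok C D -> in_range D i p ->
  exists2 g, unitri g & strand_ok C (gen i) g [:: ent D i p; ent D i p.+1].
Proof.
move=> [UC okC] rD; have [s1 [s2 [E _]]] := swap_adjP rD.
have := okC i; rewrite E => /strand_ok_cat [_ /strand_ok_cat [ok12 _]].
by exists (1 * holonomy C s1) => //; rewrite mul1r; apply: unitri_holonomy.
Qed.

Definition upd C (x : nat * bool) (v : A) (x' : nat * bool) : A := if x' == x then v else C x'.

(* Moving the tail of z across the head of x conjugates its colour by t^{+-1},
   where t is the colour of the top arc; moving the head of z across the head
   of y conjugates its colour by t^{+-1} as well, and the sign condition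
   eps_x eps_y = o_M o_B makes the two exponents equal. *)
Lemma carries_R3 i D D' : wf D -> R3move D D' -> carries i D D'.
Proof.
move=> wfD [x [y [z [ex [ey [ez [oT [oM [oB [iT [pT [iM [pM [iB [pB H]]]]]]]]]]]]]]].
case: H => uxyz [PT [PM [PB [sgE [_ ->]]]]] C [okC Cht].
have [nxy nxz nyz] : [/\ x != y, x != z & y != z].
  by move: uxyz; rewrite /= !inE !negb_or andbT => /andP[/andP[-> ->] ->].
have uD := wf_ukeys wfD; have UC := okC.1.
have Cxy : C (y, false) = C (x, false).
  have [g _] := strands_ok_pair okC PT.1.
  by case: oT PT => -[_ [-> ->]] /= [-> [-> _]].
have [okC1 hol1] : strands_ok C (swap_adj D iT pT) /\
    forall k, holonomy C (nth [::] (swap_adj D iT pT) k) = holonomy C (nth [::] D k).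
  apply: strands_ok_swap (uD) (PT.1) (okC) (UC) (fun _ _ _ => erefl) _ _.
    by case: oT PT => -[_ [-> ->]]; rewrite /holonomy !big_cons !big_nil.
  by move=> g _; case: oT PT => -[_ [-> ->]] /= [? [? _]].
have uD1 := ukeys_swap PT.1 uD.
have PM1 : pair_at (swap_adj D iT pT) iM pM oM (hd x ex) (tl z ez).
  by apply: pair_at_swap PT PM _ _; rewrite !inE /tl /hd !xpair_eqE ?andbF // ?[z == _]eq_sym ?(negPf nxz) ?(negPf nyz).
have PB1 : pair_at (swap_adj D iT pT) iB pB oB (hd y ey) (hd z ez).
  by apply: pair_at_swap PT PB _ _; rewrite !inE /tl /hd !xpair_eqE ?andbF.
set D1 := swap_adj D iT pT in okC1 hol1 uD1 PM1 PB1 *.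
have PB2 : pair_at (swap_adj D1 iM pM) iB pB oB (hd y ey) (hd z ez).
  by apply: pair_at_swap PM1 PB1 _ _; rewrite !inE /tl /hd !xpair_eqE ?andbF //
    eq_sym ?(negPf nxy) ?(negPf nxz).
set t := C (x, false) in Cxy; set c := C (z, false).
have Ut : unitri t by apply: UC.
have [q [qM qB]] : exists q, q = pw (ex == oM) t /\ q = pw (ey == oB) t.
  exists (pw (ex == oM) t); split=> //; congr pw.
  by move: sgE; case: (ex) (ey) (oM) (oB) => [] [] [] [].
have Uq : unitri q by rewrite qM; apply: unitri_pw.
have [uq ut uc] := And3 (unitri_unit Uq) (unitri_unit Ut) (unitri_unit (UC (z, false))).
pose v := conjm c q^-1.
have Uv : unitri v by apply: unitri_conjm; [apply: UC | apply: unitriV].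
have Uupd C0 x0 : (forall x, unitri (C0 x)) -> forall x, unitri (upd C0 x0 v x).
  by move=> U0 x1; rewrite /upd; case: ifP.
(* The tail of z is recoloured with the middle swap and its head with the bottom swap; the two keys
   agree again only at the end. *)
pose C2 := upd C (z, false) v; pose C3 := upd C2 (z, true) v.
have [okC2 hol2] : strands_ok C2 (swap_adj D1 iM pM) /\
    forall k, holonomy C2 (nth [::] (swap_adj D1 iM pM) k) = holonomy C (nth [::] D1 k).
  have C2x : C2 (x, true) = t by rewrite /C2 /upd xpair_eqE andbF Cht.
  have C2z : C2 (z, false) = v by rewrite /C2 /upd eqxx.
  have [rM entM] := PM1.
  apply: strands_ok_swap (uD1) (rM) (okC1) (Uupd _ _ UC) _ _ _.
  - by move=> x0; case: (oM) entM => -[-> ->] /= n1 n2; rewrite /upd ?(negPf n1) ?(negPf n2).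
  - by case: (oM) entM => -[-> ->];
      rewrite /holonomy !big_cons !big_nil /= /headval /= -/C2 C2x Cht.
  move=> g Ug; have ug := unitri_unit Ug.
  case: (oM) entM qM => -[-> ->] /=; rewrite /headval /= ?Cht -/t -/c -/C2 => qM.
    move=> [cE _]; split=> //; rewrite C2z /v cE.
    have -> : pw ex t = q by rewrite qM; case: (ex).
    by rewrite -conjm_mul ?unitrMl ?unitrV // mulrK.
  move=> [cE _]; split=> //; rewrite C2z C2x /v cE -conjm_mul ?unitrV //.
  by congr (conjm _ (_ * _)); rewrite qM -pwN; case: (ex).
have uD2 := ukeys_swap PM1.1 uD1.
have [okC3 hol3] : strands_ok C3 (swap_adj (swap_adj D1 iM pM) iB pB) /\
    forall k, holonomy C3 (nth [::] (swap_adj (swap_adj D1 iM pM) iB pB) k)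
            = holonomy C2 (nth [::] (swap_adj D1 iM pM) k).
  have C2y : C2 (y, true) = t by rewrite /C2 /upd xpair_eqE andbF Cht.
  have C2z : C2 (z, true) = c by rewrite /C2 /upd xpair_eqE andbF Cht.
  have C3y : C3 (y, true) = t by rewrite /C3 /upd xpair_eqE (negPf nyz).
  have C3z : C3 (z, true) = v by rewrite /C3 /upd eqxx.
  have [rB entB] := PB2.
  apply: strands_ok_swap (uD2) (rB) (okC2) (Uupd _ _ okC2.1) _ _ _.
  - by move=> x0; case: (oB) entB => -[-> ->] /= n1 n2; rewrite {1}/upd ?(negPf n1) ?(negPf n2).
  - have vE : pw ez v = q * pw ez c * q^-1 by rewrite /v pw_conjm ?unitrV // /conjm invrK.
    case: (oB) entB qB => -[-> ->];
      rewrite /holonomy !big_cons !big_nil /= /headval /= -/C3 C2y C2z C3y C3z vE !mulr1.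
      have -> : (ey == true) = ey by case: (ey).
      by move=> <-; rewrite mulrVK.
    have -> : (ey == false) = ~~ ey by case: (ey).
    by rewrite pwN => ->; rewrite invrK -!mulrA mulVKr // unitri_unit //; apply: unitri_pw.
  by move=> g _; case: (oB) entB => -[-> ->].
exists C3; last by rewrite hol3 hol2 hol1.
split=> // a; rewrite /C3 /C2 /upd !xpair_eqE !andbT !andbF.
by case: (a == z).
Qed.

End Colourings.

(** * Invariance of the longitude and reduction modulo n *)

Section Invariance.
Context (R : comUnitRingType) (M : seq nat) (i n : nat).
Hypotheses (uniqM : uniq M) (iM : i \notin M) (n0 : (n%:R = 0 :> R)%R).

(** Deletions and relabellings carry colourings from D' to D, R3 and OC from D to D'. One direction
    per move suffices because the conclusion is an equality. *)
Lemma Vn_sv_equiv_longitude p D D' : size M <= p -> Vn_sv_equiv n D D' ->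
  rho R M (vword D p i (size (heads D i))) = rho R M (vword D' p i (size (heads D' i))).
Proof.
move=> led; elim=> {D D'} [D D' [wfD [wfD' step]] | D | D D' _ E | D1 D2 D3 _ E12 _ E23] //;
  last by rewrite E12.
have car D1 D2 wf1 wf2 := @carries_longitude R M uniqM i p D1 D2 wf1 wf2 led.
case: step => [|[|[|[|[|[]]]]]].
- by move/R1_sv/(carries_sv uniqM iM wfD')/(car _ _ wfD' wfD)/esym.
- by move/(carries_R2 i wfD')/(car _ _ wfD' wfD)/esym.
- by move/(carries_R3 i wfD)/(car _ _ wfD wfD').
- by move/(carries_OC i wfD)/(car _ _ wfD wfD').
- by move/(carries_relabel i)/(car _ _ wfD' wfD)/esym.
- by move/(carries_Vn uniqM i wfD' n0)/(car _ _ wfD' wfD)/esym.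
- by move/(carries_sv uniqM iM wfD')/(car _ _ wfD' wfD)/esym.
Qed.

(** The correcting power of alpha_i maps to 1 because i does not occur in M; row 0 corresponds to
    the full monomial. *)
Lemma mcoef_longitude p D :
  ((mcoef (longitude D p i) M)%:~R =
     rho R M (vword D p i (size (heads D i))) ord0 ord_max)%R.
Proof.
have := rho_mcoef R uniqM (longitude D p i) ord0; rewrite drop0 => <-.
by rewrite rho_cat rho_gen_pow // mul1r.
Qed.

End Invariance.

Lemma intr_Zp_eq_mod n (a b : int) : 1 < n ->
  (a%:~R = b%:~R :> 'Z_n)%R -> (a == b %[mod n%:Z])%Z.
Proof.
move=> n1 ab; rewrite eqz_mod_dvd.
have : ((a - b)%:~R = 0 :> 'Z_n)%R by rewrite rmorphB /= ab subrr.
have natZ k : (k%:R = 0 :> 'Z_n)%R -> n %| k.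
  by move/(congr1 val); rewrite /= val_Zp_nat // => /eqP.
case: (a - b)%R => k; first by rewrite -pmulrn => /natZ.
by rewrite NegzE mulrNz => /eqP; rewrite oppr_eq0 -pmulrn => /eqP /natZ.
Qed.

Theorem theorem3p1 (m n : nat) (sigma sigma' : diagram) :
  0 < n ->
  size sigma = m -> size sigma' = m -> wf sigma -> wf sigma' ->
  Vn_sv_equiv n sigma sigma' ->
  forall I : seq 'I_m, uniq I ->
    (mu_w sigma (map val I) == mu_w sigma' (map val I) %[mod (n%:Z)])%Z.
Proof.
move=> n_gt0 _ _ _ _ eqv I uI.
(* The type ['Z_1] has two elements by convention, so n = 1, where every congruence holds, is
   treated apart. *)
have [n1|] := ltnP 1 n; last first.
  by move=> n_le1; have -> : n = 1 by [apply/eqP; rewrite eqn_leq n_le1]; rewrite !modz1.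
have {uI} : uniq (map val I) by rewrite map_inj_uniq //; apply: val_inj.
(* For an empty sequence both invariants are 0. Otherwise the last entry is the strand i and the
   others form M; non-repetition yields both [uniq M] and the absence of i from M. *)
case: (map val I) => [//|x I']; rewrite lastI rcons_uniq => /andP[iM uM].
apply: intr_Zp_eq_mod => //; rewrite /mu_w -lastI !mcoef_longitude //.
rewrite (Vn_sv_equiv_longitude uM iM _ _ eqv) ?size_belast //=.
by apply/val_inj; rewrite /= val_Zp_nat // modnn.
Qed.
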